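(* Let $p\ge 2$ be an integer and $R>0$ real. Then $$\zeta(p)=\sum_{n=0}^{\infty}\frac{S_n^p R^{n+1}}{n+1}+\sum_{n=0}^{\infty}\frac{(-1)^{n}s(n+p-1,p-1)}{(n+p-1)\,(n+p-1)!}\left(\frac{\gamma(n+p,R)}{R^{n+p-1}}+e^{-R}\right),$$ where $\zeta$ is the Riemann zeta function.
   Context: $S_n^p=\frac{(-1)^n}{n!}\sum_{k=0}^{n}\frac{(-1)^{k}\binom{n}{k}}{(k+1)^p}$ (generalized Stirling numbers of the second kind). $s(n,k)$ are the Stirling numbers of the first kind, defined by $\frac{\ln^k(1+t)}{k!}=\sum_{n=k}^{\infty}s(n,k)\frac{t^n}{n!}$ for $|t|<1$. $\gamma(a,x)=\int_0^x u^{a-1}e^{-u}\,du$ is the lower incomplete Gamma function. *)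

(* Defs.v *)
From Stdlib Require Import Arith Reals Lra Lia.
From Coquelicot Require Import Coquelicot.
Open Scope R_scope.

(* Complex values of the argument are not covered: [zeta s] is the Riemann zeta
   function for real [s > 1], the half-line on which the series converges. *)
Definition zeta (s : R) : R := Series (fun n : nat => / Rpower (INR (S n)) s).

(* The lower limit is the one-sided limit [u -> 0+], so that the integral is
   meaningful for every real [a > 0], including the improper case [a < 1]. *)
Definition lower_gamma (a x : R) : R :=
  RInt_gen (fun u : R => Rpower u (a - 1) * exp (- u)) (at_right 0) (at_point x).

(* [Binomial.C] is qualified because Coquelicot's [C] is the complex field;
   [sum_f_R0 f n] has the [n + 1] terms [f 0], ..., [f n]. *)
Definition gen_stirling2 (n p : nat) : R :=
  (-1) ^ n / INR (fact n) *
  sum_f_R0 (fun k : nat => (-1) ^ k * Binomial.C n k / (INR k + 1) ^ p) n.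

(* [s n k] is the Stirling number of the first kind for all [k <= n], as the
   coefficients of a power series are determined by its sum.  The summation
   index is [n = m + k]; values [s n k] with [n < k] are left unconstrained. *)
Definition is_stirling1 (s : nat -> nat -> R) : Prop :=
  forall (k : nat) (t : R), Rabs t < 1 ->
    is_series (fun m : nat => s (m + k)%nat k * (t ^ (m + k) / INR (fact (m + k))))
              (ln (1 + t) ^ k / INR (fact k)).

Lemma CV_radius_unit_disk (a : nat -> R) :
  (forall x, Rabs x < 1 -> ex_pseries a x) ->
  forall x, Rabs x < 1 -> Rbar_lt (Rabs x) (CV_radius a).
Proof.
intros H x Hx.
apply Rbar_not_le_lt; intros Hc.
set (y := (Rabs x + 1) / 2).
pose proof (Rabs_pos x) as H0.
assert (Hy : Rabs y = y) by (apply Rabs_pos_eq; unfold y; lra).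
apply (CV_disk_outside a y).
- rewrite Hy; apply Rbar_le_lt_trans with (1 := Hc); simpl; unfold y; lra.
- apply ex_series_lim_0.
  apply ex_series_ext with (2 := proj1 (ex_pseries_R a y) (H y ltac:(rewrite Hy; unfold y; lra))).
  reflexivity.
Qed.

Definition log_coef : nat -> R := PS_Int (fun n => (-1) ^ n).

Lemma is_pseries_geom_alt (x : R) :
  Rabs x < 1 -> is_pseries (fun n => (-1) ^ n) x (/ (1 + x)).
Proof.
intros Hx; apply is_pseries_R.
replace (/ (1 + x)) with (/ (1 - - x)) by (f_equal; ring).
apply is_series_ext with (fun n => (- x) ^ n).
- intros n; rewrite <- Rpow_mult_distr; f_equal; ring.
- apply is_series_geom; now rewrite Rabs_Ropp.
Qed.

Lemma is_pseries_log (x : R) : Rabs x < 1 -> is_pseries log_coef x (ln (1 + x)).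
Proof.
intros Hx.
assert (Hr : Rbar_lt (Rabs x) (CV_radius (fun n => (-1) ^ n))).
{ apply CV_radius_unit_disk; trivial.
  intros y Hy; eexists; now apply is_pseries_geom_alt. }
replace (ln (1 + x)) with (RInt (PSeries (fun n => (-1) ^ n)) 0 x).
{ now apply is_pseries_RInt. }
apply is_RInt_unique.
assert (Hin : forall y, Rmin 0 x <= y <= Rmax 0 x -> Rabs y < 1).
{ intros y; apply Rabs_def2 in Hx; unfold Rmin, Rmax; destruct Rle_dec;
  intros; apply Rabs_def1; lra. }
apply is_RInt_ext with (fun y => / (1 + y)).
{ intros y Hy; symmetry; apply is_pseries_unique, is_pseries_geom_alt, Hin; lra. }
replace (ln (1 + x)) with (minus (ln (1 + x)) (ln (1 + 0)))
  by (unfold minus, plus, opp; simpl; rewrite Rplus_0_r, ln_1; ring).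
apply (is_RInt_derive (fun y => ln (1 + y)));
  intros y Hy; apply Hin, Rabs_def2 in Hy.
- auto_derive; [lra | field; lra].
- apply (ex_derive_continuous (fun y => / (1 + y))); auto_derive; lra.
Qed.

Fixpoint log_pow_coef (k : nat) : nat -> R :=
  match k with
  | O => fun n => match n with O => 1 | S _ => 0 end
  | S k' => PS_mult log_coef (log_pow_coef k')
  end.

Lemma is_pseries_log_pow (k : nat) (x : R) :
  Rabs x < 1 -> is_pseries (log_pow_coef k) x (ln (1 + x) ^ k).
Proof.
revert x; induction k as [|k IH]; intros x Hx; simpl.
- apply is_pseries_R.
  apply (is_series_decr_1 (fun n => match n with O => 1 | S _ => 0 end * x ^ n)).
  apply is_series_ext with (fun _ => 0).
  + intros n; now rewrite Rmult_0_l.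
  + replace (plus _ _) with 0 by (unfold plus, opp; simpl; ring).
    apply filterlim_ext with (fun _ => 0); [|apply filterlim_const].
    intros n; rewrite sum_n_const; ring.
- apply is_pseries_mult;
  [now apply is_pseries_log | now apply IH | |];
  apply CV_radius_unit_disk; trivial; intros y Hy; eexists.
  + now apply is_pseries_log.
  + now apply IH.
Qed.

Lemma log_pow_coef_low (k n : nat) : (n < k)%nat -> log_pow_coef k n = 0.
Proof.
revert n; induction k as [|k IH]; intros n Hn; [lia|]; simpl; unfold PS_mult.
rewrite (sum_eq _ (fun _ => 0)), sum_cte; [ring|].
intros [|i] Hi; [unfold log_coef, PS_Int|rewrite IH by lia]; ring.
Qed.

(* [is_stirling1] is satisfiable, so quantifying over it is not vacuous. *)
Lemma is_stirling1_exists : exists s, is_stirling1 s.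
Proof.
exists (fun n k => INR (fact n) / INR (fact k) * log_pow_coef k n).
intros k t Ht.
pose proof (fun n => INR_fact_neq_0 n) as Hf.
apply is_series_ext with (fun m => scal (/ INR (fact k)) (log_pow_coef k (m + k) * t ^ (m + k))).
{ intros m; unfold scal; simpl; unfold mult; simpl; field; auto. }
replace (ln (1 + t) ^ k / INR (fact k)) with (scal (/ INR (fact k)) (ln (1 + t) ^ k))
  by (unfold scal; simpl; unfold mult; simpl; field; auto).
apply (is_series_scal (V := R_NormedModule)).
pose proof (proj1 (is_pseries_R _ _ _) (is_pseries_log_pow k t Ht)) as H.
destruct k as [|k].
{ apply is_series_ext with (2 := H); intros n; now rewrite Nat.add_0_r. }
apply is_series_ext with (fun m => log_pow_coef (S k) (S k + m) * t ^ (S k + m)).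
{ intros m; now rewrite (Nat.add_comm m). }
apply (is_series_incr_n (fun n => log_pow_coef (S k) n * t ^ n)); [lia|].
rewrite (sum_n_ext_loc _ (fun _ => 0)), sum_n_const.
- replace (plus _ _) with (ln (1 + t) ^ S k); trivial.
  unfold plus; simpl; ring.
- intros n Hn; rewrite log_pow_coef_low by (simpl in Hn; lia); apply Rmult_0_l.
Qed.

(* Main.v *)
Require Import Defs.
From Stdlib Require Import Arith Reals Lra Lia.
From Coquelicot Require Import Coquelicot.
Open Scope R_scope.

(** Put [q = p - 1] and [c n = |s n q| / n!], the coefficients of
    [L(v) = (- ln (1 - v)) ^ q / q!], and consider the moments
    [M n k = sum_i c (i + 1) * beta (i + n) k], that is, the integral of
    [L(v) / v * v ^ n * (1 - v) ^ k] over [[0, 1]].  Summation by parts gives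
    [M 1 k = 1 / (k + 1) ^ p]; as [M (n + 1) k = M n k - M n (k + 1)], telescoping
    gives [M 0 0 = zeta p], and iterated differences give [M (n + 1) 0] as the
    alternating binomial sum in [gen_stirling2 n p].  The second series is the
    integral of [L(v) / v * exp (- r v)]: its terms, expanded in powers of [r] and
    summed in the other order, give [sum_j (- r) ^ j / j! * M j 0], in which the term
    [j = 0] is [zeta p] and the others form the opposite of the first series. *)

(** * Convergence and comparison of series *)

Lemma is_series_lim (u : nat -> R) (l : R) :
  is_series u l <-> is_lim_seq (sum_f_R0 u) l.
Proof. rewrite is_series_Reals; symmetry; apply is_lim_seq_Reals. Qed.

Lemma ex_series_mult_l (c : R) (u : nat -> R) :
  ex_series u -> ex_series (fun n => c * u n).
Proof. apply (ex_series_scal_l (K := R_AbsRing) (V := R_NormedModule) c). Qed.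

Lemma ex_series_dominated (u v : nat -> R) :
  (forall n, Rabs (u n) <= v n) -> ex_series v -> ex_series u.
Proof. apply (ex_series_le (V := R_CompleteNormedModule)). Qed.

Lemma INR_S_neq_0 (n : nat) : INR (S n) <> 0.
Proof. apply not_0_INR; lia. Qed.

Lemma INR_S_pos (n : nat) : 0 < INR (S n).
Proof. apply lt_0_INR; lia. Qed.

(** * Normalised Stirling numbers and their recurrence *)

(* For [is_stirling1 s] and [q <= n] this is [|s n q| / n!]. *)
Fixpoint stirling1_ratio (q n : nat) : R :=
  match q, n with
  | O, O => 1
  | O, S _ => 0
  | S _, O => 0
  | S q', S n' => sum_f_R0 (stirling1_ratio q') n' / INR (S n')
  end.

Lemma stirling1_ratio_rec (q n : nat) :
  INR (S n) * stirling1_ratio (S q) (S n) = sum_f_R0 (stirling1_ratio q) n.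
Proof.
change (stirling1_ratio (S q) (S n)) with (sum_f_R0 (stirling1_ratio q) n / INR (S n)).
field; apply INR_S_neq_0.
Qed.

Lemma stirling1_ratio_low (q n : nat) : (n < q)%nat -> stirling1_ratio q n = 0.
Proof.
revert n; induction q as [|q IH]; intros [|n] Hn; try lia; trivial.
apply Rmult_eq_reg_l with (INR (S n)); [|apply INR_S_neq_0].
rewrite stirling1_ratio_rec, Rmult_0_r; apply sum_eq_R0.
intros i Hi; apply IH; lia.
Qed.

Lemma stirling1_ratio_pos (q n : nat) : 0 <= stirling1_ratio q n.
Proof.
revert n; induction q as [|q IH]; intros [|n]; simpl stirling1_ratio; try lra.
apply Rdiv_le_0_compat; [now apply cond_pos_sum | apply INR_S_pos].
Qed.

(** By the recurrence, row [S q] consists of the Cesaro means of row [q], shifted by one. *)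
Lemma stirling1_ratio_lim (q : nat) : is_lim_seq (stirling1_ratio q) 0.
Proof.
induction q as [|q IH]; apply is_lim_seq_incr_1.
- apply (is_lim_seq_const 0).
- apply is_lim_seq_Reals, Cesaro_1, is_lim_seq_Reals, is_lim_seq_incr_1 in IH.
  now apply is_lim_seq_ext with (2 := IH).
Qed.

(** * Beta integrals and summation by parts *)

(* The Euler integral of [x ^ n * (1 - x) ^ k] over [[0, 1]]. *)
Definition beta (n k : nat) : R := INR (fact n) * INR (fact k) / INR (fact (n + k + 1)).

(** One factor [x] of the integrand is written [1 - (1 - x)]. *)
Lemma beta_succ_l (n k : nat) : beta (S n) k = beta n k - beta n (S k).
Proof.
unfold beta; rewrite ?Nat.add_1_r, ?Nat.add_succ_r, ?Nat.add_succ_l,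
  !fact_simpl, !mult_INR, !S_INR, plus_INR.
pose proof (pos_INR n); pose proof (pos_INR k).
field; split; [apply INR_fact_neq_0 | lra].
Qed.

Lemma beta_0_r (n : nat) : beta n 0 = / INR (S n).
Proof.
unfold beta; rewrite Nat.add_0_r, Nat.add_1_r, !fact_simpl, mult_INR; simpl (INR (fact 0)).
field; split; (apply INR_fact_neq_0 || apply INR_S_neq_0).
Qed.

Lemma beta_0_l (k : nat) : beta 0 k = / INR (S k).
Proof.
unfold beta; rewrite Nat.add_0_l, Nat.add_1_r, !fact_simpl, mult_INR; simpl (INR (fact 0)).
field; split; (apply INR_fact_neq_0 || apply INR_S_neq_0).
Qed.

(** Integration by parts gives [INR (S n) * beta n (S k)] on the right, and [beta_succ_l] rewrites
    [beta n (S k)]. *)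
Lemma beta_parts (n k : nat) :
  INR (S k) * beta (S n) k = INR (S n) * (beta n k - beta (S n) k).
Proof.
unfold beta; rewrite ?Nat.add_1_r, ?Nat.add_succ_r, ?Nat.add_succ_l,
  !fact_simpl, !mult_INR, !S_INR, plus_INR.
pose proof (pos_INR n); pose proof (pos_INR k).
field; split; [apply INR_fact_neq_0 | lra].
Qed.

Lemma beta_pos (n k : nat) : 0 < beta n k.
Proof. apply Rdiv_lt_0_compat; [apply Rmult_lt_0_compat|]; apply INR_fact_lt_0. Qed.

(** The ratio [beta n (S k) / beta n k = (k + 1) / (n + k + 2)] is at most [(k + 1) / (k + 2)], and
    the product of these bounds telescopes. *)
Lemma beta_le (n k : nat) : beta n k <= beta n 0 * / INR (S k).
Proof.
induction k as [|k IH]; [simpl; lra|].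
replace (beta n (S k)) with (beta n k * (INR (S k) / (INR n + INR (S (S k))))).
- apply Rle_trans with (beta n k * (INR (S k) / INR (S (S k)))).
  + apply Rmult_le_compat_l; [apply Rlt_le, beta_pos|].
    apply Rmult_le_compat_l; [apply pos_INR|].
    apply Rinv_le_contravar; [apply INR_S_pos | pose proof (pos_INR n); lra].
  + replace (/ INR (S (S k))) with (/ INR (S k) * (INR (S k) / INR (S (S k))))
      by (field; split; apply INR_S_neq_0).
    rewrite <- Rmult_assoc; apply Rmult_le_compat_r, IH.
    apply Rdiv_le_0_compat; [apply pos_INR | apply INR_S_pos].
- unfold beta; rewrite ?Nat.add_1_r, ?Nat.add_succ_r,
  !fact_simpl, !mult_INR, !S_INR, plus_INR.
  pose proof (pos_INR n); pose proof (pos_INR k).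
  field; split; [apply INR_fact_neq_0 | lra].
Qed.

Lemma beta_le_0_r (n k : nat) : beta n k <= / INR (S n).
Proof.
rewrite <- beta_0_r; apply Rle_trans with (1 := beta_le n k).
rewrite <- (Rmult_1_r (beta n 0)) at 2; apply Rmult_le_compat_l; [apply Rlt_le, beta_pos|].
rewrite <- Rinv_1; apply Rinv_le_contravar; [lra | rewrite S_INR; pose proof (pos_INR k); lra].
Qed.

(** Abel summation: [INR (S n) * stirling1_ratio (S q) (S n)] is a partial sum of row [q], and
    [beta_parts] supplies the differences of [beta]. The last term is the boundary term. *)
Lemma stirling1_ratio_beta_sum (q k n : nat) :
  INR (S k) * sum_f_R0 (fun i => stirling1_ratio (S q) i * beta i k) n =
  sum_f_R0 (fun i => stirling1_ratio q i * beta i k) n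
  - INR (S n) * stirling1_ratio (S q) (S n) * beta n k.
Proof.
induction n as [|n IH].
- rewrite stirling1_ratio_rec; simpl; ring.
- rewrite !tech5, Rmult_plus_distr_l, IH, !stirling1_ratio_rec, tech5.
  replace (INR (S k) * (stirling1_ratio (S q) (S n) * beta (S n) k))
    with (stirling1_ratio (S q) (S n) * (INR (S k) * beta (S n) k)) by ring.
  rewrite beta_parts, <- Rmult_assoc, (Rmult_comm _ (INR (S n))), stirling1_ratio_rec.
  ring.
Qed.

(* Summation by parts: the discrete form of integrating
   [(- ln (1 - x)) ^ q / q! * (1 - x) ^ k] by parts over [[0, 1]]. *)
Lemma is_series_stirling1_ratio_beta (q k : nat) :
  is_series (fun n => stirling1_ratio q n * beta n k) (/ INR (S k) ^ S q).
Proof.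
induction q as [|q IH]; apply is_series_lim.
- apply is_lim_seq_ext with (fun _ => / INR (S k) ^ 1); [|apply is_lim_seq_const].
  intros n; rewrite pow_1; induction n as [|n IH].
  + simpl sum_f_R0; now rewrite beta_0_l, Rmult_1_l.
  + rewrite tech5, <- IH; simpl stirling1_ratio; ring.
- apply is_series_lim in IH.
  apply is_lim_seq_ext with (fun n => / INR (S k) *
    (sum_f_R0 (fun i => stirling1_ratio q i * beta i k) n
     - INR (S n) * stirling1_ratio (S q) (S n) * beta n k)).
  { intros n; rewrite <- stirling1_ratio_beta_sum; field; apply INR_S_neq_0. }
  replace (Finite (/ INR (S k) ^ S (S q)))
    with (Rbar_mult (/ INR (S k)) (Finite (/ INR (S k) ^ S q - 0))).
  2: { simpl; f_equal; rewrite Rminus_0_r, <- !Rinv_mult; f_equal; simpl; ring. }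
  apply is_lim_seq_scal_l, is_lim_seq_minus'; trivial.
  (* The boundary term tends to 0: [INR (S n) * beta n k <= 1] leaves only the Stirling ratio. *)
  apply is_lim_seq_le_le with (fun _ => 0) (fun n => stirling1_ratio (S q) (S n)).
  + intros n; pose proof (stirling1_ratio_pos (S q) (S n)) as Hc.
    pose proof (beta_pos n k) as Hb; pose proof (INR_S_pos n) as Hn; split.
    * apply Rmult_le_pos; [|lra]; apply Rmult_le_pos; lra.
    * apply Rle_trans with (INR (S n) * stirling1_ratio (S q) (S n) * / INR (S n)).
      -- apply Rmult_le_compat_l, beta_le_0_r; apply Rmult_le_pos; lra.
      -- right; field; apply INR_S_neq_0.
  + apply is_lim_seq_const.
  + apply -> is_lim_seq_incr_1; apply stirling1_ratio_lim.
Qed.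

(** * Logarithmic moments and the zeta value *)

Definition log_moment (q n k : nat) : R :=
  Series (fun i => stirling1_ratio q (S i) * beta (i + n) k).

Lemma beta_decr_l (n m k : nat) : beta (n + m) k <= beta n k.
Proof.
induction m as [|m IH]; [rewrite Nat.add_0_r; lra|].
rewrite Nat.add_succ_r, beta_succ_l; pose proof (beta_pos (n + m) (S k)); lra.
Qed.

(** In a row [S q] the coefficient of index 0 vanishes, so starting at index 1 loses nothing. *)
Lemma is_series_log_moment_1 (q k : nat) :
  is_series (fun i => stirling1_ratio (S q) (S i) * beta (i + 1) k) (/ INR (S k) ^ S (S q)).
Proof.
apply is_series_ext with (fun i => stirling1_ratio (S q) (S i) * beta (S i) k).
{ intros i; now rewrite Nat.add_1_r. }
apply (is_series_incr_1 (fun i => stirling1_ratio (S q) i * beta i k)).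
change (stirling1_ratio (S q) 0) with 0; rewrite Rmult_0_l.
match goal with |- is_series _ ?l => replace l with (/ INR (S k) ^ S (S q)) end.
- apply is_series_stirling1_ratio_beta.
- unfold plus; simpl; ring.
Qed.

(** Comparison with the case [n = 1], [k = 0], whose sum is known. The factor 2 covers [n = 0],
    where [1 / (i + 1) <= 2 / (i + 2)]. *)
Lemma ex_series_log_moment (q n k : nat) :
  ex_series (fun i => stirling1_ratio (S q) (S i) * beta (i + n) k).
Proof.
apply ex_series_dominated with
  (fun i => 2 * (stirling1_ratio (S q) (S i) * beta (i + 1) 0)).
- intros i.
  pose proof (stirling1_ratio_pos (S q) (S i)) as Hc.
  rewrite Rabs_pos_eq by (apply Rmult_le_pos; [trivial | apply Rlt_le, beta_pos]).
  rewrite (Rmult_comm 2), Rmult_assoc; apply Rmult_le_compat_l; trivial.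
  apply Rle_trans with (1 := beta_le_0_r _ _).
  rewrite beta_0_r, !S_INR, !plus_INR; simpl INR.
  pose proof (pos_INR i); pose proof (pos_INR n).
  replace (/ (INR i + 1 + 1) * 2) with (/ ((INR i + 1 + 1) / 2)) by (field; lra).
  apply Rinv_le_contravar; lra.
- apply (ex_series_mult_l 2); eexists; apply is_series_log_moment_1.
Qed.

Lemma log_moment_succ (q n k : nat) :
  log_moment (S q) (S n) k = log_moment (S q) n k - log_moment (S q) n (S k).
Proof.
unfold log_moment; rewrite <- Series_minus by apply ex_series_log_moment.
apply Series_ext; intros i; rewrite Nat.add_succ_r, beta_succ_l; ring.
Qed.

Lemma log_moment_1 (q k : nat) : log_moment (S q) 1 k = / INR (S k) ^ S (S q).
Proof. apply is_series_unique, is_series_log_moment_1. Qed.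

(** Summing [beta_le] termwise bounds the moment by a constant over [k + 1]. This removes the
    remainder of the telescoping sum for zeta. *)
Lemma log_moment_0_lim (q : nat) : is_lim_seq (log_moment (S q) 0) 0.
Proof.
apply is_lim_seq_le_le with (fun _ => 0) (fun k => log_moment (S q) 0 0 * / INR (S k)).
- intros k; unfold log_moment; rewrite <- Series_scal_r.
  assert (Hk : forall i, 0 <= stirling1_ratio (S q) (S i) * beta (i + 0) k <=
    stirling1_ratio (S q) (S i) * beta (i + 0) 0 * / INR (S k)).
  { intros i; pose proof (stirling1_ratio_pos (S q) (S i)) as Hc; split.
    - apply Rmult_le_pos; [trivial | apply Rlt_le, beta_pos].
    - rewrite Rmult_assoc; apply Rmult_le_compat_l; trivial; apply beta_le. }
  split.
  + rewrite <- (Rmult_0_l (Series (fun _ => 0))), <- Series_scal_l.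
    apply Series_le; [|apply ex_series_log_moment].
    intros i; rewrite Rmult_0_l; split; [lra | apply Hk].
  + apply Series_le; trivial; apply ex_series_scal_r, ex_series_log_moment.
- apply is_lim_seq_const.
- replace (Finite 0) with (Rbar_mult (log_moment (S q) 0 0) 0) by (simpl; f_equal; ring).
  apply is_lim_seq_scal_l.
  apply is_lim_seq_incr_1 with (u := fun n => / INR n).
  replace (Finite 0) with (Rbar_inv p_infty) by trivial.
  apply is_lim_seq_inv; [apply is_lim_seq_INR | discriminate].
Qed.

Lemma is_series_inv_pow (q : nat) :
  is_series (fun k => / INR (S k) ^ S (S q)) (log_moment (S q) 0 0).
Proof.
apply is_series_ext with (log_moment (S q) 1); [apply log_moment_1|].
apply is_series_lim.
apply is_lim_seq_ext with (fun k => log_moment (S q) 0 0 - log_moment (S q) 0 (S k)).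
- intros k; induction k as [|k IH]; cbn [sum_f_R0]; rewrite <- ?IH, log_moment_succ; ring.
- replace (Finite (log_moment (S q) 0 0)) with (Finite (log_moment (S q) 0 0 - 0))
    by (f_equal; ring).
  apply is_lim_seq_minus'; [apply is_lim_seq_const | apply -> is_lim_seq_incr_1; apply log_moment_0_lim].
Qed.

Lemma zeta_log_moment (q : nat) : zeta (INR (S (S q))) = log_moment (S q) 0 0.
Proof.
apply is_series_unique; apply is_series_ext with (2 := is_series_inv_pow q).
intros k; now rewrite Rpower_pow by apply INR_S_pos.
Qed.

(** * Iterated differences and the generalized Stirling numbers *)

Lemma C_0_r (n : nat) : Binomial.C n 0 = 1.
Proof. unfold Binomial.C; rewrite Nat.sub_0_r; simpl; field; apply INR_fact_neq_0. Qed.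

Lemma C_diag (n : nat) : Binomial.C n n = 1.
Proof. rewrite pascal_step1, Nat.sub_diag by lia; apply C_0_r. Qed.

(** With [E] the shift of the second index, a step in the first index acts as [1 - E]; the sum is
    the binomial expansion of [(1 - E) ^ m]. *)
Lemma iterated_difference (e : nat -> nat -> R) (n m k : nat) :
  (forall n k, e (S n) k = e n k - e n (S k)) ->
  e (n + m)%nat k = sum_f_R0 (fun i => (-1) ^ i * Binomial.C m i * e n (k + i)%nat) m.
Proof.
intros He; revert k; induction m as [|m IH]; intros k.
{ simpl; rewrite !Nat.add_0_r, C_0_r; ring. }
rewrite Nat.add_succ_r, He, !IH, (decomp_sum _ (S m)) by lia.
simpl pred; destruct m as [|m].
{ simpl sum_f_R0; rewrite ?C_diag, ?C_0_r, !Nat.add_0_r, !Nat.add_1_r; simpl; ring. }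
rewrite (decomp_sum _ (S m)) by lia; simpl pred.
rewrite (tech5 _ m), (tech5 (fun i => _ * _ * e n (k + S i)%nat) m).
rewrite !C_0_r, !C_diag.
(* Pascal's rule on the interior indices; the two end terms, outside its range, are already split
   off. *)
assert (H : sum_f_R0 (fun i => (-1) ^ S i * Binomial.C (S (S m)) (S i) * e n (k + S i)%nat) m =
  sum_f_R0 (fun i => (-1) ^ S i * Binomial.C (S m) (S i) * e n (k + S i)%nat) m
  - sum_f_R0 (fun i => (-1) ^ i * Binomial.C (S m) i * e n (S k + i)%nat) m).
{ rewrite <- minus_sum; apply sum_eq; intros i Hi.
  rewrite <- pascal by lia; rewrite Nat.add_succ_l, Nat.add_succ_r; simpl; ring. }
rewrite H. replace (k + S (S m))%nat with (S k + S m)%nat by lia; rewrite !Nat.add_0_r; cbn [pow]. ring.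
Qed.

Lemma gen_stirling2_log_moment (n q : nat) :
  gen_stirling2 n (S (S q)) = (-1) ^ n / INR (fact n) * log_moment (S q) (S n) 0.
Proof.
unfold gen_stirling2; f_equal.
change (S n) with (1 + n)%nat; rewrite (iterated_difference (log_moment (S q)) 1 n 0 (log_moment_succ q)).
apply sum_eq; intros i _; now rewrite log_moment_1, S_INR.
Qed.

(** * Interchange of summations *)

Lemma ex_series_exp (x : R) : ex_series (fun n => x ^ n / INR (fact n)).
Proof.
exists (exp x); apply is_series_ext with (2 := proj1 (is_pseries_R _ _ _) (is_exp_Reals x)).
intros n; apply Rmult_comm.
Qed.

Lemma Series_shift_lim (u : nat -> R) :
  ex_series u -> is_lim_seq (fun n => Series (fun i => u (n + i)%nat)) 0.
Proof.
intros Hu; apply is_lim_seq_incr_1.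
apply is_lim_seq_ext with (fun n => Series u - sum_f_R0 u n).
- intros n; rewrite (Series_incr_n u (S n)) by (trivial; lia); simpl pred; ring.
- replace (Finite 0) with (Finite (Series u - Series u)) by (f_equal; ring).
  apply is_lim_seq_minus'; [apply is_lim_seq_const |].
  now apply is_series_lim, Series_correct.
Qed.

(** Let [t n i] be the tail of row [i] from column [n]. Removing column [n] from [Series (t n)]
    leaves [Series (t (S n))], so the column sums telescope; the remainder is at most [Series x]
    times a tail of [y]. *)
Lemma Series_swap (a : nat -> nat -> R) (x y : nat -> R) :
  (forall i j, Rabs (a i j) <= x i * y j) -> (forall j, 0 <= y j) ->
  ex_series x -> ex_series y ->
  is_series (fun j => Series (fun i => a i j)) (Series (fun i => Series (a i))).
Proof.
intros Ha Hy Ex Ey.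
assert (Eyn : forall n, ex_series (fun j => y (n + j)%nat))
  by (intros n; now apply ex_series_incr_n).
assert (Ei : forall j, ex_series (fun i => a i j)).
{ intros j; apply ex_series_dominated with (fun i => x i * y j);
  [intros i; apply Ha | now apply ex_series_scal_r]. }
assert (Ej : forall n i, ex_series (fun j => Rabs (a i (n + j)%nat))).
{ intros n i; apply ex_series_dominated with (fun j => x i * y (n + j)%nat).
  - intros j; rewrite Rabs_Rabsolu; apply Ha.
  - now apply (ex_series_mult_l (x i)). }
set (t := fun n i => Series (fun j => a i (n + j)%nat)).
assert (Ht : forall n i, Rabs (t n i) <= x i * Series (fun j => y (n + j)%nat)).
{ intros n i; apply Rle_trans with (1 := Series_Rabs _ (Ej n i)).
  rewrite <- Series_scal_l; apply Series_le; [|now apply (ex_series_mult_l (x i))].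
  intros j; split; [apply Rabs_pos | apply Ha]. }
assert (Etabs : forall n, ex_series (fun i => Rabs (t n i))).
{ intros n; apply ex_series_dominated with
    (fun i => x i * Series (fun j => y (n + j)%nat)).
  - intros i; rewrite Rabs_Rabsolu; apply Ht.
  - now apply ex_series_scal_r. }
assert (Et : forall n, ex_series (t n)) by (intros n; now apply ex_series_Rabs).
assert (Hrec : forall n, Series (t n) = Series (fun i => a i n) + Series (t (S n))).
{ intros n; rewrite <- Series_plus by trivial; apply Series_ext; intros i.
  unfold t; rewrite Series_incr_1 by now apply ex_series_Rabs.
  rewrite Nat.add_0_r; f_equal; apply Series_ext; intros j; f_equal; lia. }
assert (Hlim : is_lim_seq (fun n => Series (t n)) 0).
{ apply is_lim_seq_abs_0.
  apply is_lim_seq_le_le with (fun _ => 0) (fun n => Series x * Series (fun j => y (n + j)%nat)).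
  - intros n; split; [apply Rabs_pos|].
    apply Rle_trans with (1 := Series_Rabs _ (Etabs n)).
    rewrite <- Series_scal_r; apply Series_le; [|now apply ex_series_scal_r].
    intros i; split; [apply Rabs_pos | apply Ht].
  - apply is_lim_seq_const.
  - replace (Finite 0) with (Rbar_mult (Series x) 0) by (simpl; f_equal; ring).
    now apply is_lim_seq_scal_l, Series_shift_lim. }
apply is_series_lim.
change (Series (fun i => Series (a i))) with (Series (t 0%nat)).
apply is_lim_seq_ext with (fun n => Series (t 0%nat) - Series (t (S n))).
- intros n; induction n as [|n IH].
  + rewrite Hrec; simpl; ring.
  + rewrite tech5, <- IH, (Hrec (S n)); ring.
- replace (Finite (Series (t 0%nat))) with (Finite (Series (t 0%nat) - 0)) by (f_equal; ring).
  apply is_lim_seq_minus'; [apply is_lim_seq_const | now apply -> (is_lim_seq_incr_1 (fun n => Series (t n)))].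
Qed.

(** * Exponential moments and the incomplete Gamma function *)

(* Coefficients of [x => RInt (fun v => v ^ n * exp (- x * v)) 0 1]. *)
Definition exp_moment_coef (n j : nat) : R := (-1) ^ j / INR (fact j) * beta (n + j) 0.

(** Since [beta (n + j) 0 <= beta n 0], the indices separate into the product form required by
    [Series_swap]. *)
Lemma exp_moment_coef_bound (n j : nat) (x : R) :
  Rabs (exp_moment_coef n j * x ^ j) <= beta n 0 * (Rabs x ^ j / INR (fact j)).
Proof.
unfold exp_moment_coef, Rdiv.
rewrite !Rabs_mult, pow_1_abs, Rmult_1_l, RPow_abs.
rewrite (Rabs_pos_eq (beta _ _)) by apply Rlt_le, beta_pos.
rewrite (Rabs_pos_eq (/ _)) by apply Rlt_le, Rinv_0_lt_compat, INR_fact_lt_0.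
rewrite (Rmult_comm (/ _)), Rmult_assoc, (Rmult_comm (/ _)).
apply Rmult_le_compat_r, beta_decr_l.
apply Rmult_le_pos; [apply Rabs_pos | apply Rlt_le, Rinv_0_lt_compat, INR_fact_lt_0].
Qed.

Lemma ex_pseries_exp_moment (n : nat) (x : R) : ex_pseries (exp_moment_coef n) x.
Proof.
apply ex_pseries_R, ex_series_dominated with
  (fun j => beta n 0 * (Rabs x ^ j / INR (fact j))).
- intros j; apply exp_moment_coef_bound.
- apply (ex_series_mult_l (beta n 0)), ex_series_exp.
Qed.

Lemma CV_radius_exp_moment (n : nat) (x : R) :
  Rbar_lt (Rabs x) (CV_radius (exp_moment_coef n)).
Proof.
apply Rbar_lt_le_trans with (Finite (Rabs x + 1)); [simpl; lra|].
apply Rbar_not_lt_le; intros Hc.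
apply (CV_disk_outside (exp_moment_coef n) (Rabs x + 1)).
- now rewrite (Rabs_pos_eq (_ + 1)) by (pose proof (Rabs_pos x); lra).
- apply ex_series_lim_0, ex_pseries_R, ex_pseries_exp_moment.
Qed.

Lemma is_derive_exp_moment (n : nat) (x : R) :
  is_derive (PSeries (exp_moment_coef n)) x (PSeries (PS_derive (exp_moment_coef n)) x).
Proof. apply is_derive_PSeries, CV_radius_exp_moment. Qed.

(** This is the integral over [v] of the derivative of [v ^ (n + 1) * exp (- x * v)]. On
    coefficients it reduces to [(n + j + 1) * beta (n + j) 0 = 1]. *)
Lemma exp_moment_ode (n : nat) (x : R) :
  x * PSeries (PS_derive (exp_moment_coef n)) x + INR (S n) * PSeries (exp_moment_coef n) x
  = exp (- x).
Proof.
assert (Hd : ex_pseries (PS_derive (exp_moment_coef n)) x)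
  by (apply CV_radius_inside; rewrite CV_radius_derive; apply CV_radius_exp_moment).
rewrite <- PSeries_incr_1, <- PSeries_scal, <- PSeries_plus.
- apply is_series_unique.
  apply is_series_ext with (2 := proj1 (is_pseries_R _ _ _) (is_exp_Reals (- x))); intros j.
  replace (- x) with (-1 * x) by ring; rewrite Rpow_mult_distr, <- Rmult_assoc.
  change (scal (x ^ j) ?c) with (x ^ j * c); f_equal.
  pose proof (pos_INR n); destruct j as [|j].
  + change (/ INR (fact 0) * (-1) ^ 0 =
      0 + INR (S n) * ((-1) ^ 0 / INR (fact 0) * beta (n + 0) 0)).
    rewrite beta_0_r, Nat.add_0_r, S_INR; simpl; field; lra.
  + change (/ INR (fact (S j)) * (-1) ^ S j =
      INR (S j) * ((-1) ^ S j / INR (fact (S j)) * beta (n + S j) 0)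
      + INR (S n) * ((-1) ^ S j / INR (fact (S j)) * beta (n + S j) 0)).
    rewrite beta_0_r, !S_INR, plus_INR, S_INR; pose proof (pos_INR j); field.
    split; (lra || apply INR_fact_neq_0).
- now apply ex_pseries_incr_1.
- apply (ex_pseries_scal (V := R_NormedModule) (INR (S n)) (exp_moment_coef n) x);
  [apply Rmult_comm | apply ex_pseries_exp_moment].
Qed.

(** By [exp_moment_ode] the right side is an antiderivative of [x ^ (n + 1) * exp (- x)], and it
    vanishes at 0. *)
Lemma lower_gamma_exp_moment (n : nat) (x : R) : 0 < x ->
  lower_gamma (INR (S (S n))) x =
  x ^ S n * (INR (S n) * PSeries (exp_moment_coef n) x - exp (- x)).
Proof.
intros Hx.
set (F := fun u => u ^ S n * (INR (S n) * PSeries (exp_moment_coef n) u - exp (- u))).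
assert (HF : forall u, is_derive F u (u ^ S n * exp (- u))).
{ intros u; pose proof (is_derive_exp_moment n u) as Hg; pose proof (exp_moment_ode n u) as Ho.
  unfold F; clear F; revert Hg Ho.
  generalize (PSeries (PS_derive (exp_moment_coef n)) u) (PSeries (exp_moment_coef n)).
  intros d g Hg Ho; auto_derive; [repeat split; now exists d|].
  replace (Derive _ u) with d by (symmetry; now apply is_derive_unique).
  rewrite <- Ho; change (pred (S n)) with n; cbn [pow].
  change (match n with O => 1 | S _ => INR n + 1 end) with (INR (S n)); ring. }
assert (HD : forall u, Derive F u = u ^ S n * exp (- u)).
{ intros u; now apply is_derive_unique. }
assert (HC : forall u, continuous F u).
{ intros u; apply (ex_derive_continuous F); eexists; apply HF. }
apply is_RInt_gen_unique.
apply is_RInt_gen_ext with (Derive F).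
(* [Rpower u] is the ordinary power only for [u > 0]; lower endpoints [a > 0] are eventual in
   [at_right 0] and keep the range positive. *)
- exists (fun a => 0 < a) (fun b => b = x).
  + exists (mkposreal 1 Rlt_0_1); intros y _ Hy; exact Hy.
  + reflexivity.
  + intros a b Ha Hb u Hu; simpl in Hu; rewrite HD.
    replace (INR (S (S n)) - 1) with (INR (S n)) by (rewrite (S_INR (S n)); ring).
    rewrite Rpower_pow; trivial.
    subst b; apply Rlt_trans with (2 := proj1 Hu); now apply Rmin_glb_lt.
- replace (x ^ S n * _) with (F x - F 0) by (unfold F; simpl; ring).
  apply is_RInt_gen_Derive.
  + apply filter_forall; intros [a b] u _; eexists; apply HF.
  + apply filter_forall; intros [a b] u _.
    apply continuous_ext with (fun u => u ^ S n * exp (- u)); [intros v; now rewrite HD|].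
    apply (ex_derive_continuous (fun u => u ^ S n * exp (- u))); auto_derive; trivial.
  + apply filterlim_filter_le_1 with (2 := HC 0); apply filter_le_within.
  + intros P HP; unfold filtermap, at_point; now apply locally_singleton.
Qed.

(** * Identification of the coefficients with Stirling numbers *)

(** Coefficient [n] times [n!] is the [n]-th derivative at 0 of the common sum. *)
Lemma PSeries_coef_unique (a b : nat -> R) (f : R -> R) :
  (forall x, Rabs x < 1 -> is_pseries a x (f x)) ->
  (forall x, Rabs x < 1 -> is_pseries b x (f x)) ->
  forall n, a n = b n.
Proof.
intros Ha Hb n.
assert (H0 : Rabs 0 < 1) by (rewrite Rabs_R0; lra).
assert (Hr : forall c, (forall x, Rabs x < 1 -> is_pseries c x (f x)) -> Rbar_lt 0 (CV_radius c)).
{ intros c Hc; rewrite <- Rabs_R0; apply CV_radius_unit_disk; trivial.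
  intros x Hx; eexists; now apply Hc. }
apply Rmult_eq_reg_r with (INR (fact n)); [|apply INR_fact_neq_0].
rewrite <- !Derive_n_coef by now apply Hr.
apply Derive_n_ext_loc; exists (mkposreal 1 Rlt_0_1); intros x Hx.
assert (Hx1 : Rabs x < 1) by (rewrite <- (Rminus_0_r x); exact Hx).
now rewrite (is_pseries_unique _ _ _ (Ha x Hx1)), (is_pseries_unique _ _ _ (Hb x Hx1)).
Qed.

(* The test is needed because [is_stirling1 s] leaves [s n q] free for [n < q]. *)
Definition signed_stirling1_ratio (s : nat -> nat -> R) (q n : nat) : R :=
  if (n <? q)%nat then 0 else (-1) ^ (n + q) * s n q / INR (fact n).

Lemma is_pseries_signed_stirling1_ratio (s : nat -> nat -> R) (q : nat) (x : R) :
  is_stirling1 s -> Rabs x < 1 ->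
  is_pseries (signed_stirling1_ratio s q) x ((- ln (1 - x)) ^ q / INR (fact q)).
Proof.
intros Hs Hx; apply is_pseries_R.
set (u := fun n => signed_stirling1_ratio s q n * x ^ n).
assert (Hu : is_series (fun m => u (q + m)%nat) ((- ln (1 - x)) ^ q / INR (fact q))).
{ specialize (Hs q (- x)); rewrite Rabs_Ropp in Hs; specialize (Hs Hx).
  apply (is_series_scal (V := R_NormedModule) ((-1) ^ q)) in Hs.
  replace ((- ln (1 - x)) ^ q / INR (fact q))
    with (scal ((-1) ^ q) (ln (1 + - x) ^ q / INR (fact q))).
  - apply is_series_ext with (2 := Hs); intros m.
    unfold u, signed_stirling1_ratio, scal; simpl; unfold mult; simpl.
    replace (q + m <? q)%nat with false by (symmetry; apply Nat.ltb_ge; lia).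
    rewrite (Nat.add_comm q m); replace (- x) with (-1 * x) by ring.
    rewrite Rpow_mult_distr, pow_add with (n := (m + q)%nat); unfold Rdiv; ring.
  - unfold scal; simpl; unfold mult; simpl.
    replace (- ln (1 - x)) with (-1 * ln (1 + - x)) by (unfold Rminus; ring).
    rewrite Rpow_mult_distr; unfold Rdiv; ring. }
(* For a positive order, the terms below it are zero by the test in the definition and can be
   prepended. *)
destruct q as [|q]; [exact Hu|].
apply is_series_decr_n with (S q); [lia|].
match goal with |- is_series _ ?l => replace l with ((- ln (1 - x)) ^ S q / INR (fact (S q))) end; trivial.
rewrite sum_n_Reals, sum_eq_R0; [unfold plus, opp; simpl; ring|].
intros n Hn; unfold u, signed_stirling1_ratio; simpl pred in Hn.
replace (n <? S q)%nat with true by (symmetry; apply Nat.ltb_lt; lia); ring.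
Qed.

Lemma is_pseries_PS_derive (a : nat -> R) (f df : R -> R) :
  (forall x, Rabs x < 1 -> is_pseries a x (f x)) ->
  (forall x, Rabs x < 1 -> is_derive f x (df x)) ->
  forall x, Rabs x < 1 -> is_pseries (PS_derive a) x (df x).
Proof.
intros Ha Hf x Hx.
assert (Hr : Rbar_lt (Rabs x) (CV_radius a)).
{ apply CV_radius_unit_disk; trivial; intros y Hy; eexists; now apply Ha. }
replace (df x) with (Derive (PSeries a) x); [now apply is_pseries_derive|].
rewrite <- (is_derive_unique _ _ _ (Hf x Hx)); apply Derive_ext_loc.
assert (Hd : 0 < 1 - Rabs x) by lra.
exists (mkposreal _ Hd); intros y Hy; apply is_pseries_unique, Ha.
change (Rabs (y - x) < 1 - Rabs x) in Hy.
replace y with (x + (y - x)) by ring; apply Rle_lt_trans with (1 := Rabs_triang _ _); lra.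
Qed.

Lemma is_pseries_geom (x : R) : Rabs x < 1 -> is_pseries (fun _ => 1) x (/ (1 - x)).
Proof.
intros Hx; apply is_pseries_R; apply is_series_ext with (fun n => x ^ n).
- intros n; symmetry; apply Rmult_1_l.
- now apply is_series_geom.
Qed.

(** The derivative of [(- ln (1 - x)) ^ (q + 1) / (q + 1)!] is the function of order [q] times
    [1 / (1 - x)], and that factor turns coefficients into partial sums: the recurrence of
    [stirling1_ratio]. *)
Lemma stirling1_ratio_spec (s : nat -> nat -> R) (q n : nat) :
  is_stirling1 s -> signed_stirling1_ratio s q n = stirling1_ratio q n.
Proof.
intros Hs; revert n; induction q as [|q IH]; intros n.
- apply PSeries_coef_unique with (fun _ => 1); intros x Hx.
  + replace 1 with ((- ln (1 - x)) ^ 0 / INR (fact 0)) by (simpl; field).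
    now apply is_pseries_signed_stirling1_ratio.
  + apply is_pseries_R, is_series_lim.
    apply is_lim_seq_ext with (fun _ => 1); [|apply is_lim_seq_const].
    intros m; induction m as [|m IH]; cbn [sum_f_R0]; rewrite <- ?IH; simpl; ring.
- destruct n as [|n]; [reflexivity|].
  apply Rmult_eq_reg_l with (INR (S n)); [|apply INR_S_neq_0].
  rewrite stirling1_ratio_rec, <- (sum_eq _ _ n (fun i _ => IH i)).
  change (PS_derive (signed_stirling1_ratio s (S q)) n = sum_f_R0 (signed_stirling1_ratio s q) n).
  replace (sum_f_R0 (signed_stirling1_ratio s q) n)
    with (PS_mult (signed_stirling1_ratio s q) (fun _ => 1) n)
    by (apply sum_eq; intros i _; ring).
  apply PSeries_coef_unique with (fun x => (- ln (1 - x)) ^ q / INR (fact q) * / (1 - x)).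
  + apply is_pseries_PS_derive with (fun x => (- ln (1 - x)) ^ S q / INR (fact (S q))).
    { intros x Hx; now apply is_pseries_signed_stirling1_ratio. }
    intros x Hx; apply Rabs_def2 in Hx; auto_derive; [lra|].
    change (match q with O => 1 | S _ => INR q + 1 end) with (INR (S q)).
    change (fact q + q * fact q)%nat with (S q * fact q)%nat.
    rewrite mult_INR; change (1 + - x) with (1 - x).
    field; repeat split; (lra || apply INR_fact_neq_0 || apply INR_S_neq_0).
  + intros x Hx; apply is_pseries_mult;
    [now apply is_pseries_signed_stirling1_ratio | now apply is_pseries_geom | |];
    apply CV_radius_unit_disk; trivial; intros y Hy; eexists;
    [now apply is_pseries_signed_stirling1_ratio | now apply is_pseries_geom].
Qed.

(** * Evaluation of the two series *)

(** The added exponential cancels the one in [lower_gamma_exp_moment], leaving a multiple of the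
    exponential moment. *)
Lemma lower_gamma_term (n : nat) (x : R) : 0 < x ->
  lower_gamma (INR (S (S n))) x / x ^ S n + exp (- x) =
  INR (S n) * PSeries (exp_moment_coef n) x.
Proof.
intros Hx; rewrite lower_gamma_exp_moment by trivial.
field; apply pow_nonzero; lra.
Qed.

Lemma is_series_log_moment_exp (q : nat) (x : R) :
  is_series (fun j => (-1) ^ j / INR (fact j) * x ^ j * log_moment (S q) j 0)
    (Series (fun i => stirling1_ratio (S q) (S i) * PSeries (exp_moment_coef i) x)).
Proof.
set (a := fun i j => stirling1_ratio (S q) (S i) * (exp_moment_coef i j * x ^ j)).
apply is_series_ext with (fun j => Series (fun i => a i j)).
{ intros j; unfold log_moment; rewrite <- Series_scal_l; apply Series_ext; intros i.
  unfold a, exp_moment_coef; ring. }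
rewrite (Series_ext _ (fun i => Series (a i))) by (intros i; symmetry; apply Series_scal_l).
(* The dominating factors are the terms of [log_moment (S q) 0 0] and those of [exp (Rabs x)]. *)
apply Series_swap with (fun i => stirling1_ratio (S q) (S i) * beta (i + 0) 0)
  (fun j => Rabs x ^ j / INR (fact j)); unfold a.
- intros i j; rewrite Rabs_mult, Rabs_pos_eq, Rmult_assoc by apply stirling1_ratio_pos.
  apply Rmult_le_compat_l; [apply stirling1_ratio_pos|].
  rewrite Nat.add_0_r; apply exp_moment_coef_bound.
- intros j; apply Rdiv_le_0_compat; [apply pow_le, Rabs_pos | apply INR_fact_lt_0].
- apply ex_series_log_moment.
- apply ex_series_exp.
Qed.

(** [Series] has a value even without convergence, so summability of the outer series is shown
    separately, by the same bound as for the interchange. *)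
Lemma ex_series_exp_moment (q : nat) (x : R) :
  ex_series (fun i => stirling1_ratio (S q) (S i) * PSeries (exp_moment_coef i) x).
Proof.
apply ex_series_dominated with
  (fun i => stirling1_ratio (S q) (S i) * beta (i + 0) 0 * Series (fun j => Rabs x ^ j / INR (fact j))).
- intros i; rewrite Rabs_mult, Rabs_pos_eq, Rmult_assoc by apply stirling1_ratio_pos.
  apply Rmult_le_compat_l; [apply stirling1_ratio_pos|].
  assert (Hb : ex_series (fun j => beta i 0 * (Rabs x ^ j / INR (fact j))))
    by apply ex_series_mult_l, ex_series_exp.
  rewrite Nat.add_0_r, <- Series_scal_l; apply Rle_trans with
    (Series (fun j => Rabs (exp_moment_coef i j * x ^ j))).
  + apply Series_Rabs, ex_series_dominated with (2 := Hb).
    intros j; rewrite Rabs_Rabsolu; apply exp_moment_coef_bound.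
  + apply Series_le; trivial.
    intros j; split; [apply Rabs_pos | apply exp_moment_coef_bound].
- apply ex_series_scal_r, ex_series_log_moment.
Qed.

Theorem theorem6 (s : nat -> nat -> R) (hs : is_stirling1 s)
  (p : nat) (hp : (2 <= p)%nat) (r : R) (hr : 0 < r) :
  let A := fun n : nat => gen_stirling2 n p * r ^ (n + 1) / (INR n + 1) in
  let B := fun n : nat =>
    (-1) ^ n * s (n + p - 1)%nat (p - 1)%nat
      / (INR (n + p - 1) * INR (fact (n + p - 1)))
      * (lower_gamma (INR (n + p)) r / r ^ (n + p - 1) + exp (- r)) in
  ex_series A /\ ex_series B /\ zeta (INR p) = Series A + Series B.
Proof.
intros A B.
destruct p as [|[|q]]; [lia | lia |].
set (b := fun i => stirling1_ratio (S q) (S i) * PSeries (exp_moment_coef i) r).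
assert (HB : forall n, B n = b (q + n)%nat).
{ intros n; unfold B, b.
  replace (n + S (S q))%nat with (S (S (q + n))) by lia.
  simpl (S (S q) - 1)%nat; simpl (S (S (q + n)) - 1)%nat.
  rewrite lower_gamma_term, <- (stirling1_ratio_spec s) by trivial.
  unfold signed_stirling1_ratio.
  replace (S (q + n) <? S q)%nat with false by (symmetry; apply Nat.ltb_ge; lia).
  (* The sign in [signed_stirling1_ratio] reduces to [(-1) ^ n], as [2 * S q] is even. *)
  replace (S (q + n) + S q)%nat with (2 * S q + n)%nat by lia.
  rewrite pow_add, pow_1_even.
  field; split; [apply INR_fact_neq_0 | apply INR_S_neq_0]. }
assert (Hb : is_series B (Series b)).
{ apply is_series_ext with (fun n => b (q + n)%nat); [intros n; now rewrite HB|].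
  assert (H := Series_correct _ (ex_series_exp_moment q r)); fold b in H.
  (* The first [q] terms of [b] vanish by [stirling1_ratio_low]; for [q = 0] there is nothing to
     drop. *)
  destruct q as [|q]; [exact H|].
  apply (is_series_incr_n b); [lia|].
  rewrite sum_n_Reals, sum_eq_R0.
  - match goal with |- is_series _ ?l => replace l with (Series b) end; trivial.
    unfold plus; simpl; ring.
  - intros n Hn; simpl pred in Hn; unfold b.
    rewrite stirling1_ratio_low by lia; ring. }
assert (HA : is_series A (log_moment (S q) 0 0 - Series b)).
{ assert (H := is_series_log_moment_exp q r); fold b in H.
  (* [A n] is the opposite of the term [j = S n]: the factor [1 / (n + 1)] completes [n!] to
     [(n + 1)!]. *)
  apply is_series_ext with (fun n =>
    opp ((-1) ^ S n / INR (fact (S n)) * r ^ S n * log_moment (S q) (S n) 0)).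
  - intros n; unfold A; rewrite gen_stirling2_log_moment, Nat.add_1_r, fact_simpl, mult_INR, <- S_INR.
    unfold opp; simpl ((-1) ^ S n); cbn -[INR fact pow log_moment].
    field; split; (apply INR_fact_neq_0 || apply INR_S_neq_0).
  - replace (log_moment (S q) 0 0 - Series b) with (opp (Series b - log_moment (S q) 0 0))
      by (unfold opp; simpl; ring).
    apply (is_series_opp (V := R_NormedModule)).
    apply (is_series_incr_1
      (fun j => (-1) ^ j / INR (fact j) * r ^ j * log_moment (S q) j 0)).
    match goal with |- is_series _ ?l => replace l with (Series b) end; trivial.
    unfold plus; simpl; field. }
split; [eexists; exact HA | split; [eexists; exact Hb|]].
rewrite (is_series_unique _ _ HA), (is_series_unique _ _ Hb), zeta_log_moment; ring.
Qed.
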